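(* Let $\Gamma$ be a spine of a bordered surface $\Sigma_{g,\delta^1}$, containing a pending edge with coordinate $Z$ attached at a three-valent vertex whose two other edges are distinct and have coordinates $Y_1,Y_2$ (either or both of these may themselves be pending), such that moving from $Y_1$ into the vertex one turns left to the pending edge $Z$ and right to $Y_2$. Let $\tilde\Gamma$ be obtained from $\Gamma$ by moving the pending edge to the other side, so that moving from $Y_1$ one turns right to the pending edge and left to $Y_2$; $\tilde\Gamma$ is a spine of a surface $\Sigma_{g,\delta^2}$ with the same genus, the same number of boundary components and the same total number of marked points. Then the transformation $$e^{\tilde Y_1}=e^{Y_1}\bigl(1+e^{-2Z}\bigr)^{-1},\qquad e^{\tilde Y_2}=e^{Y_2}\bigl(1+e^{2Z}\bigr),\qquad e^{\tilde Z}=e^{-Z},$$ with all other coordinates unchanged, is a morphism between the Teichmüller spaces $\mathcal T^H_{g,\delta^1}$ and $\mathcal T^H_{g,\delta^2}$ (parameterized by the shear coordinates on $\Gamma$ and $\tilde\Gamma$) which preserves both the Poisson structure and the geodesic functions: the Poisson bracket of $\Gamma$ goes to that of $\tilde\Gamma$, and $G_\gamma=G_{\tilde\gamma}$ for every closed path $\gamma$ in $\Gamma$, where $\tilde\gamma$ is the corresponding closed path in $\tilde\Gamma$.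
   Context: Spines. A spine of $\Sigma_{g,\delta}$, $\delta=\{\delta_1,\dots,\delta_s\}$ (genus $g$, $s$ boundary components, $\delta_i\ge0$ marked points on the $i$th one), is a connected fatgraph with three-valent and one-valent (pending) vertices, embedded in the surface so that faces correspond to boundary components and the $i$th face contains $\delta_i$ pending vertices. An edge ending at a pending vertex is a pending edge. Each edge $\alpha$ carries a real shear coordinate $Z_\alpha$; these are coordinates on $\mathcal T^H_{g,\delta}$. Poisson structure. $\sum_v\sum_{i=1}^3 \frac{\partial}{\partial Z_{v_i}}\wedge\frac{\partial}{\partial Z_{v_{i+1}}}$, where $v$ runs over the three-valent vertices and $v_1,v_2,v_3$ (indices mod 3) are the cyclically ordered edges incident to $v$. Geodesic functions. Put $$X_Z=\begin{pmatrix}0&-e^{Z/2}\\ e^{-Z/2}&0\end{pmatrix},\quad R=\begin{pmatrix}1&1\\-1&0\end{pmatrix},\quad L=\begin{pmatrix}0&1\\-1&-1\end{pmatrix},\quad F=\begin{pmatrix}0&1\\-1&0\end{pmatrix}.$$ Closed paths $\gamma$ are without backtracking, except that a path entering a pending edge is inverted at the pending vertex and returns along this edge. $G_\gamma=\operatorname{tr}P_\gamma$, where $P_\gamma$ is the product (written from right to left along the path) of $X_{Z_\alpha}$ for each passage of an inner edge, $X_ZFX_Z$ for each visit to a pending edge with coordinate $Z$, and $L$ or $R$ for each left or right turn. Correspondence of paths. $\tilde\gamma$ is obtained from $\gamma$ by replacing passages near the flipped edge as follows (and similarly for the reversed passages): $Y_1\to Z\to Y_2$ becomes $Y_1\to Y_2$;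 $Y_1\to Y_2$ becomes $Y_1\to\tilde Z\to Y_2$; $Y_1\to Z\to Y_1$ becomes $Y_1\to\tilde Z\to Y_1$; $Y_2\to Z\to Y_2$ becomes $Y_2\to\tilde Z\to Y_2$; the rest of the path is unchanged. *)

(* Defs.v *)
From HB Require Import structures.
From mathcomp Require Import all_boot all_order all_algebra all_fingroup.
From mathcomp Require Import all_classical all_reals all_analysis.
Import numFieldNormedType.Exports.

Set Implicit Arguments.
Unset Strict Implicit.
Unset Printing Implicit Defensive.

Import GRing.Theory.

Local Open Scope ring_scope.

(* The edges are labelled by 'I_n, and the edge e has the two half-edges
   (e, false) and (e, true). A half-edge is attached to a vertex; it also
   stands for the edge e oriented away from that vertex. *)
Notation half_edge n := ('I_n * bool)%type.

Definition mate n (d : half_edge n) : half_edge n := (d.1, ~~ d.2).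

Lemma mateK n : involutive (@mate n).
Proof. by case=> e b; rewrite /mate /= negbK. Qed.

(* A fatgraph is given by the permutation G sending a half-edge to the next one,
   counterclockwise, around its vertex; the vertices are the orbits of G.
   A path that arrives at a vertex through the half-edge d leaves it through
   G d when it turns right, and through G^-1 d when it turns left. *)
Definition turn_right n (G : {perm half_edge n}) (d : half_edge n) :
  half_edge n := G d.

Definition turn_left n (G : {perm half_edge n}) (d : half_edge n) :
  half_edge n := (G^-1)%g d.

Definition univalent n (G : {perm half_edge n}) (d : half_edge n) : bool :=
  #|porbit G d| == 1%N.

Definition trivalent n (G : {perm half_edge n}) (d : half_edge n) : bool :=
  #|porbit G d| == 3%N.

Definition is_fatgraph n (G : {perm half_edge n}) : Prop :=
  (forall d, univalent G d || trivalent G d) /\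
  (forall d d', connect (fun a b => (b == mate a) || (b == G a)) d d').

(* Going along d and then turning left: the orbits are the faces. *)
Definition face_perm n (G : {perm half_edge n}) : {perm half_edge n} :=
  (perm (inv_inj (@mateK n)) * G^-1)%g.

(* G is a spine of the surface of genus g with s boundary components and
   delta i marked points on the i-th one: capping off the s boundary components
   gives a closed connected surface of Euler characteristic 2 - 2g, and
   boundary i labels the i-th face. *)
Definition is_spine n (G : {perm half_edge n}) (g s : nat)
    (delta : 'I_s -> nat) : Prop :=
  [/\ is_fatgraph G,
      (#|porbits G| + #|porbits (face_perm G)| + 2 * g = n + 2)%N &
      exists boundary : 'I_s -> {set half_edge n},
        [/\ injective boundary,
            [set boundary i | i : 'I_s] = porbits (face_perm G) &
            forall i, delta i = #|[set d in boundary i | univalent G d]|]].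

(* z is a pending edge at a three-valent vertex whose other half-edges y1 and y2
   belong to distinct edges; coming from y1, one turns left to z and right
   to y2. *)
Definition pending_at n (G : {perm half_edge n}) (y1 z y2 : half_edge n) :
  Prop :=
  [/\ trivalent G y1, univalent G (mate z), y1.1 != y2.1,
      turn_left G y1 = z & turn_right G y1 = y2].

(* G' is obtained from G by reversing the cyclic order at that vertex, so that
   coming from y1 one turns right to z and left to y2. *)
Definition pending_flip n (G G' : {perm half_edge n}) (y1 z y2 : half_edge n) :
  Prop :=
  [/\ G' y1 = z, G' z = y2, G' y2 = y1 &
      forall d, d \notin [:: y1; z; y2] -> G' d = G d].

Definition flip_coord (R : realType) n (y1 z y2 : 'I_n) (x : 'rV[R]_n) :
  'rV[R]_n :=
  \row_j
    if j == y1 then ln (expR (x 0 y1) * (1 + expR (- (2 * x 0 z)))^-1)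
    else if j == y2 then ln (expR (x 0 y2) * (1 + expR (2 * x 0 z)))
    else if j == z then - x 0 z
    else x 0 j.

Definition partial (R : realType) n (i : 'I_n) (f : 'rV[R]_n -> R) :
  'rV[R]_n -> R := fun x => 'D_(delta_mx 0 i) f x.

(* C^oo: all iterated partial derivatives are differentiable. *)
Definition smooth (R : realType) n (f : 'rV[R]_n -> R) : Prop :=
  forall (s : seq 'I_n) (x : 'rV[R]_n), differentiable (foldr (@partial R n) f s) x.

Definition smooth_map (R : realType) n m (phi : 'rV[R]_n -> 'rV[R]_m) : Prop :=
  forall j : 'I_m, smooth (fun x => phi x 0 j).

(* The bracket {f, h} of the bivector
   \sum_v \sum_i d/dZ_(v_i) /\ d/dZ_(v_(i+1)). *)
Definition poisson_bracket (R : realType) n (G : {perm half_edge n})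
    (f h : 'rV[R]_n -> R) (x : 'rV[R]_n) : R :=
  \sum_(v in porbits G | #|v| == 3%N) \sum_(d in v)
    (partial d.1 f x * partial (G d).1 h x
     - partial (G d).1 f x * partial d.1 h x).

(* A closed path is the cyclic sequence of the oriented edges it follows; a visit
   to a pending edge contributes both orientations, one after the other. *)
Definition path_step n (G : {perm half_edge n}) (d d' : half_edge n) : bool :=
  if univalent G (mate d) then d' == mate d
  else (d' == turn_left G (mate d)) || (d' == turn_right G (mate d)).

Definition closed_path n (G : {perm half_edge n}) (c : seq (half_edge n)) :
  bool := (c != [::]) && path.cycle (path_step G) c.

Definition mx22 (R : realType) (a b c d : R) : 'M[R]_2 :=
  \matrix_(i, j) nth 0 (nth [::] [:: [:: a; b]; [:: c; d]] i) j.

Definition mxX (R : realType) (Z : R) : 'M[R]_2 :=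
  mx22 0 (- expR (Z / 2)) (expR (- (Z / 2))) 0.
Definition mxR (R : realType) : 'M[R]_2 := mx22 1 1 (-1) 0.
Definition mxL (R : realType) : 'M[R]_2 := mx22 0 1 (-1) (-1).
Definition mxF (R : realType) : 'M[R]_2 := mx22 0 1 (-1) 0.

Definition turn_mx (R : realType) n (G : {perm half_edge n})
    (d d' : half_edge n) : 'M[R]_2 :=
  if univalent G (mate d) then mxF R
  else if d' == turn_left G (mate d) then mxL R else mxR R.

(* The list is reversed since the matrices are multiplied from right to left. *)
Definition geodesic_fun (R : realType) n (G : {perm half_edge n})
    (x : 'rV[R]_n) (c : seq (half_edge n)) : R :=
  \tr (\prod_(w <- rev (zip c (rot 1 c)))
         (turn_mx R G w.1 w.2 * mxX (x 0 w.1.1))).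

(* Only the half-edges attached to the flipped vertex are y1, z and y2, so that
   mate y1 is the edge Y1 oriented towards that vertex. *)
Definition flip_passage n (y1 z y2 : half_edge n)
    (p : seq (half_edge n) * seq (half_edge n)) : Prop :=
  p \in [:: ([:: mate y1; z; mate z; y2], [:: mate y1; y2]);
            ([:: mate y2; z; mate z; y1], [:: mate y2; y1]);
            ([:: mate y1; y2], [:: mate y1; z; mate z; y2]);
            ([:: mate y2; y1], [:: mate y2; z; mate z; y1]);
            ([:: mate y1; z; mate z; y1], [:: mate y1; z; mate z; y1]);
            ([:: mate y2; z; mate z; y2], [:: mate y2; z; mate z; y2])]
  \/ exists2 d, d.1 \notin [:: y1.1; z.1; y2.1] & p = ([:: d], [:: d]).

(* Closed paths are considered up to the choice of their starting point. *)
Definition corresponding_path n (y1 z y2 : half_edge n)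
    (c c' : seq (half_edge n)) : Prop :=
  exists (ps : seq (seq (half_edge n) * seq (half_edge n))) (i j : nat),
    [/\ forall p, p \in ps -> flip_passage y1 z y2 p,
        c = rot i (flatten [seq p.1 | p <- ps]) &
        c' = rot j (flatten [seq p.2 | p <- ps])].

(* Main.v *)
Require Import Defs.
From HB Require Import structures.
From mathcomp Require Import all_boot all_order all_algebra all_fingroup.
From mathcomp Require Import all_classical all_reals all_analysis.
From mathcomp Require Import ring.
Import numFieldNormedType.Exports.

Set Implicit Arguments.
Unset Strict Implicit.
Unset Printing Implicit Defensive.

Import Order.TTheory GRing.Theory Num.Theory.

Local Open Scope ring_scope.

(** A flip only modifies the fatgraph at one vertex, so each of the four
    claims reduces to a computation at that vertex. Write [y1], [z], [y2] for
    its half-edges: [G] turns them in the order [y1 -> y2 -> z -> y1] and [G']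
    in the opposite order. The record [flipped] collects this local picture;
    it is symmetric under exchanging [G] with [G'] and [y1] with [y2], which
    halves the work.

    Type of the surface. The two fatgraphs have the same vertices. The face of
    [G] that contains [mate y1] runs through [mate y1, z, mate z, y2], while
    in [G'] the pair [z, mate z] sits between [mate y2] and [y1]. Apart from
    this pair the faces agree, so moving the pair from one face to the other
    is a bijection of faces ([spine_flipped]); the Euler characteristic and
    the total number of pending vertices are then unchanged.

    Geodesic functions. A closed path cuts into passages through the flipped
    vertex and steps away from it ([walk_passages]). The trace of the product
    of matrices along the path is computed passage by passage with [holonomy],
    which is multiplicative under concatenation. Everything then comes down to
    six identities between products of 2x2 matrices ([passage_products]). With
    [a, b, c] the exponentials of half of [Z, Y1, Y2] and [w ^ 2 = 1 + a ^ 4],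
    the new coordinates correspond to [1 / a], [b a^2 / w] and [c w], and all
    entries match because of the relation between [w] and [a].

    Smoothness. Up to a linear term the new coordinates are multiples of
    [ln (1 + e^(2Z))]. Its derivative is [2 (1 - s)], where [s = 1 / (1 + e^(2Z))]
    satisfies [s' = - 2 (s - s^2)]; hence the functions obtained by repeated
    differentiation are polynomials in [s] ([smooth_fermi_family]).

    Poisson bracket. By the chain rule the flip only changes the derivative
    along [Z], from [f_Z] to [- f_Z + 2 s f_Y1 + 2 (1 - s) f_Y2]
    ([partial_comp_flip_coord]). Since [z] is pending it is met only at the
    flipped vertex, where the two coefficients add up to [2]: the contribution
    [f_Y1 /\ f_Y2] becomes [(1 - 2) f_Y1 /\ f_Y2], and the two other
    contributions change sign too, which is the effect of reversing the cyclic
    order. *)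

(** * The local picture at the flipped vertex *)

(** Used with [r] the identity to compare the vertices of two fatgraphs, and
    with [r] a retraction to compare their faces. *)
Lemma porbit_homo (T T' : finType) (s : {perm T}) (t : {perm T'})
    (r : T -> T') :
  (forall a, r (s a) \in porbit t (r a)) ->
  forall a b, b \in porbit s a -> r b \in porbit t (r a).
Proof.
move=> hr a _ /porbitP[k ->]; elim: k => [|k IHk].
  by rewrite expg0 perm1 porbit_id.
move: (hr ((s ^+ k)%g a)) IHk; rewrite expgSr permM -!eq_porbit_mem.
by move=> /eqP ->.
Qed.

Lemma mem_porbit1 (T : finType) (s : {perm T}) x : s x \in porbit s x.
Proof. by have := mem_porbit s 1 x; rewrite expg1. Qed.

Lemma univalentE n (G : {perm half_edge n}) d : univalent G d = (G d == d).
Proof.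
apply/eqP/eqP => [d1|Gd]; first by have := iter_porbit G d; rewrite d1.
have := uniq_traject_porbit G d; have := card_porbit_neq0 G d.
by case: #|_| => [|[|k]] //= _; rewrite Gd inE eqxx.
Qed.

Lemma edge_eqE n (d a : half_edge n) : (d.1 == a.1) = (d == a) || (d == mate a).
Proof.
by case: d a => [i [|]] [j [|]]; rewrite !xpair_eqE /= ?andbT ?andbF ?orbF.
Qed.

Lemma mate_eq n (d a : half_edge n) : (mate d == a) = (d == mate a).
Proof. by rewrite -(inj_eq (inv_inj (@mateK n))) mateK. Qed.

(** Unlike [pending_at] and [pending_flip], this description treats the two
    fatgraphs alike, so that by [flipped_sym] most inclusions and implications
    need a proof in one direction only. *)
Record flipped n (G G' : {perm half_edge n}) (y1 z y2 : half_edge n) : Prop :=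
  Flipped {
    flipped_y1 : G y1 = y2; flipped_y2 : G y2 = z; flipped_z : G z = y1;
    flipped_y1' : G' y1 = z; flipped_z' : G' z = y2; flipped_y2' : G' y2 = y1;
    flipped_pending : G (mate z) = mate z;
    flipped_out : forall d, d \notin [:: y1; z; y2] -> G' d = G d;
    flipped_uniq : uniq [:: y1; mate y1; z; mate z; y2; mate y2] }.

Lemma pending_flip_flipped n (G G' : {perm half_edge n}) y1 z y2 :
  pending_at G y1 z y2 -> pending_flip G G' y1 z y2 -> flipped G G' y1 z y2.
Proof.
move=> [/eqP card3 + ny12 zE y2E] [y1E' zE' y2E' outE].
rewrite univalentE => /eqP mz; rewrite /turn_left /turn_right in zE y2E.
have Gz : G z = y1 by rewrite -zE permKV.
have [it uq] := (iter_porbit G y1, uniq_traject_porbit G y1).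
move: it uq; rewrite card3 /= y2E => Gy2.
have {}Gy2 : G y2 = z by apply: (@perm_inj _ G); rewrite Gy2 Gz.
rewrite Gy2 !inE negb_or => /andP[/andP[n12 n1z] /andP[n2z _]].
have nmz a b : G a = b -> a != b -> a != mate z.
  by move=> ab; apply: contra_neq => az; rewrite -ab az mz.
have m1 : y1 != mate z by apply: nmz y2E n12.
have m2 : y2 != mate z by apply: nmz Gy2 n2z.
have mN a : (a == mate a :> half_edge n) = false.
  by case: a => i []; rewrite xpair_eqE andbF.
split=> //; move: ny12; rewrite edge_eqE negb_or => /andP[_ m12] /=.
rewrite !inE !(mate_eq, mateK, mN) /= !negb_or (eq_sym z y2).
by rewrite (eq_sym z (mate y2)) !(mate_eq, mateK) n12 n1z m1 m12 n2z m2.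
Qed.

Lemma mate_neq n (d : half_edge n) : (d == mate d) = false.
Proof. by case: d => i []; rewrite xpair_eqE andbF. Qed.

(** The equations are oriented so that, together with [mate_eq] and [mateK],
    they decide every comparison between two of these half-edges by rewriting.
    *)
Lemma flipped_neq n (G G' : {perm half_edge n}) y1 z y2 :
  flipped G G' y1 z y2 ->
  (((y1 == y2) = false) * ((y1 == z) = false) * ((z == y2) = false) *
  ((y2 == y1) = false) * ((z == y1) = false) * ((y2 == z) = false) *
  ((y1 == mate y2) = false) * ((y1 == mate z) = false) *
  ((z == mate y2) = false) * ((y2 == mate y1) = false) *
  ((z == mate y1) = false) * ((y2 == mate z) = false))%type.
Proof.
case=> _ _ _ _ _ _ _ _.
rewrite /= !inE !(mate_eq, mateK, mate_neq) /= !negb_or.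
case/and5P=> /and4P[/negPf a /negPf b /negPf c /negPf d] _.
case/andP=> /negPf e /negPf f _ _.
by do !split; rewrite ?(a, b, c, d, e, f) // eq_sym ?mate_eq (a, b, c, d, e, f).
Qed.

Lemma flipped_sym n (G G' : {perm half_edge n}) y1 z y2 :
  flipped G G' y1 z y2 -> flipped G' G y2 z y1.
Proof.
move=> fl; have neq := flipped_neq fl; 
case: fl => e1 e2 ez e1' ez' e2' pz out uq.
split=> //.
- by rewrite out // !inE !(mate_eq, mateK, mate_neq, neq).
- move=> d d_out; rewrite out //; apply: contra d_out.
  by rewrite !inE => /or3P[] ->; rewrite ?orbT.
- by rewrite /= !inE !(mate_eq, mateK, mate_neq, neq).
Qed.

(** A cycle and its inverse have the same orbits, so flipping does not
    change the vertices. *)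
Lemma porbit_flipped n (G G' : {perm half_edge n}) y1 z y2 :
  flipped G G' y1 z y2 -> porbit G' =1 porbit G.
Proof.
have sub H H' a b c : @flipped n H H' a b c -> forall d e,
    e \in porbit H' d -> e \in porbit H d.
  move=> fl; apply: (porbit_homo (r := id)) => d.
  have [|d_out] := boolP (d \in [:: a; b; c]); last first.
    by rewrite (flipped_out fl) // mem_porbit1.
  have HH u : H (H u) \in porbit H u by have := mem_porbit H 2 u; rewrite permX.
  rewrite !inE => /or3P[] /eqP ->.
  - by rewrite (flipped_y1' fl) -(flipped_y2 fl) -(flipped_y1 fl) HH.
  - by rewrite (flipped_z' fl) -(flipped_y1 fl) -(flipped_z fl) HH.
  - by rewrite (flipped_y2' fl) -(flipped_z fl) -(flipped_y2 fl) HH.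
move=> fl d; apply/setP => e; apply/idP/idP; first exact: sub fl _ _.
exact: sub (flipped_sym fl) _ _.
Qed.

Lemma porbits_flipped n (G G' : {perm half_edge n}) y1 z y2 :
  flipped G G' y1 z y2 -> porbits G' = porbits G.
Proof. by move=> fl; apply: eq_imset; exact: porbit_flipped fl. Qed.

Lemma univalent_flipped n (G G' : {perm half_edge n}) y1 z y2 :
  flipped G G' y1 z y2 -> univalent G' =1 univalent G.
Proof. by move=> fl d; rewrite /univalent (porbit_flipped fl). Qed.

(** Connectedness is preserved because [G a] still lies in the vertex of
    [a], hence is reached from [a] by iterating [G']. *)
Lemma fatgraph_flipped n (G G' : {perm half_edge n}) y1 z y2 :
  flipped G G' y1 z y2 -> is_fatgraph G -> is_fatgraph G'.
Proof.
move=> fl [val conn]; split=> [d|d d'].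
  by rewrite (univalent_flipped fl) /trivalent (porbit_flipped fl); apply: val.
apply: connect_sub (conn d d') => a b /orP[/eqP ->|/eqP ->].
  by apply: connect1; rewrite eqxx.
have /porbitP[k ->] : G a \in porbit G' a.
  by rewrite (porbit_flipped fl) mem_porbit1.
elim: k => [|k IHk]; first by rewrite expg0 perm1 connect0.
by apply: connect_trans IHk (connect1 _); rewrite expgSr permM eqxx orbT.
Qed.

Lemma turn_left_flipped n (G G' : {perm half_edge n}) y1 z y2 d :
  flipped G G' y1 z y2 -> d \notin [:: y1; z; y2] ->
  turn_left G' d = turn_left G d.
Proof.
move=> fl d_out; apply: (@perm_inj _ G').
rewrite permKV (flipped_out fl) ?permKV //.
apply: contra d_out; set u := turn_left G d.
have -> : d = G u by rewrite permKV.
rewrite !inE; case/or3P=> /eqP ->.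
- by rewrite (flipped_y1 fl) eqxx !orbT.
- by rewrite (flipped_z fl) eqxx.
- by rewrite (flipped_y2 fl) eqxx orbT.
Qed.

(** * Faces and the type of the surface *)

Lemma face_permE n (G : {perm half_edge n}) d :
  face_perm G d = turn_left G (mate d).
Proof.
rewrite /face_perm /turn_left permM.
have -> : perm (inv_inj (@mateK n)) d = mate d by rewrite permE.
by [].
Qed.
Lemma turn_left_eq n (G : {perm half_edge n}) d e :
  (turn_left G d == e) = (d == G e).
Proof. by rewrite -(inj_eq (@perm_inj _ G)) permKV. Qed.

(** Contracts the pending edge to [a]. When [a] precedes the pending edge in
    its face, this is a retraction that keeps every half-edge in its face. *)
Definition collapse n (z a d : half_edge n) : half_edge n :=
  if d.1 == z.1 then a else d.

(** The face permutation of [G] sends [mate y1] to [z] and [z] to [mate z],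
    so each of these steps is collapsed to a point. Away from the pending edge
    the successors in the two face permutations lie in the same face of [G'], so
    collapsing maps faces of [G] into faces of [G']. *)
Lemma face_flipped n (G G' : {perm half_edge n}) y1 z y2 d e :
  flipped G G' y1 z y2 -> e \in porbit (face_perm G) d ->
  collapse z (mate y1) e \in porbit (face_perm G') (collapse z (mate y1) d).
Proof.
move=> fl; have neq := flipped_neq fl.
apply: (porbit_homo (r := collapse z (mate y1))) => {d e} d.
have lE a b : G b = a -> turn_left G a = b.
  by move=> e; apply/eqP; rewrite turn_left_eq e.
have lE' a b : G' b = a -> turn_left G' a = b.
  by move=> e; apply/eqP; rewrite turn_left_eq e.
rewrite /collapse face_permE !edge_eqE.
have [d_in|] := boolP (mate d \in [:: y1; z; y2; mate z]).
  move: d_in; rewrite !inE !mate_eq mateK => /or4P[] /eqP ->.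
  - by rewrite mateK (lE _ _ (flipped_z fl)) eqxx /= if_same porbit_id.
  - rewrite mateK (lE _ _ (flipped_y2 fl)).
    rewrite !(mate_eq, mateK, mate_neq, neq, eqxx, orbT).
    have := mem_porbit1 (face_perm G') (mate y1).
    by rewrite face_permE mateK (lE' _ _ (flipped_y2' fl)).
  - rewrite mateK (lE _ _ (flipped_y1 fl)) !(mate_eq, mateK, neq) /=.
    have := mem_porbit (face_perm G') 3 (mate y2).
    rewrite !permX /= !face_permE mateK (lE' _ _ (flipped_z' fl)).
    rewrite (lE' _ _ (flipped_pending (flipped_sym fl))).
    by rewrite mateK (lE' _ _ (flipped_y1' fl)).
  - by rewrite (lE _ _ (flipped_pending fl)) !eqxx orbT porbit_id.
rewrite !inE !negb_or => /and4P[n1 nz n2 nmz].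
rewrite !turn_left_eq (flipped_z fl) (flipped_pending fl).
rewrite (negPf n1) (negPf nmz).
rewrite -(inj_eq (inv_inj (@mateK n)) d) -[d == mate z]mate_eq.
rewrite (negPf nmz) (negPf nz) /=.
have := mem_porbit1 (face_perm G') d.
by rewrite face_permE (turn_left_flipped fl) // !inE !negb_or n1 nz n2.
Qed.

(** The orbit of a point is the only orbit that contains it, which turns a
    sum over orbits into a sum over points. *)
Lemma big_porbits (V : Type) (idx : V) (op : Monoid.com_law idx) (T : finType)
    (s : {perm T}) (Q : pred {set T}) (P : pred T) (F : T -> V) :
  \big[op/idx]_(B in porbits s | Q B) \big[op/idx]_(d in B | P d) F d
  = \big[op/idx]_(d | Q (porbit s d) && P d) F d.
Proof.
rewrite [RHS](partition_big (porbit s) (fun B => (B \in porbits s) && Q B)) /=.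
  apply: eq_bigr => _ /andP[/imsetP[e _ ->] Qe]; apply: eq_bigl => d.
  rewrite -eq_porbit_mem andbC; case: eqP => [->|]; last by rewrite !andbF.
  by rewrite Qe.
by move=> d /andP[-> _]; rewrite imset_f.
Qed.

Lemma sum_boundary n (f : {perm half_edge n}) s
    (boundary : 'I_s -> {set half_edge n}) (P : pred (half_edge n)) :
  injective boundary -> [set boundary i | i : 'I_s] = porbits f ->
  (\sum_i #|[set d in boundary i | P d]| = #|[set d | P d]|)%N.
Proof.
move=> inj im; under eq_bigr do rewrite -sum1dep_card.
rewrite -(big_imset (fun B : {set _} => \sum_(d in B | P d) 1)%N) /=;
  last exact: in2W.
under eq_bigl do rewrite im.
have := big_porbits addn f predT P (fun=> 1%N).
by under eq_bigl do rewrite andbT; rewrite sum1dep_card.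
Qed.

(** The bijection of faces is [push]: it takes a face of [G], removes the
    pending pair [z, mate z], and adds this pair again if the face contains
    [mate y2]. *)
Lemma spine_flipped n (G G' : {perm half_edge n}) y1 z y2 g s
    (delta1 : 'I_s -> nat) :
  flipped G G' y1 z y2 -> is_spine G g delta1 ->
  exists delta2 : 'I_s -> nat,
    is_spine G' g delta2 /\
    (\sum_(i < s) delta2 i)%N = (\sum_(i < s) delta1 i)%N.
Proof.
move=> fl [fat chi [boundary [inj im deltaE]]]; have neq := flipped_neq fl.
pose f := face_perm G; pose f' := face_perm G'.
have collapse_out a d : d.1 != z.1 -> collapse z a d = d.
  by rewrite /collapse => /negPf ->.
have y1_out d : (collapse z (mate y1) d).1 != z.1.
  rewrite /collapse; case: ifP => [_|->//].
  by rewrite edge_eqE !(mate_eq, mateK, neq).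
have y2_out d : (collapse z (mate y2) d).1 != z.1.
  rewrite /collapse; case: ifP => [_|->//].
  by rewrite edge_eqE !(mate_eq, mateK, neq).
(* [collapse z (mate y2)] retracts the half-edges of [G'] within their faces, so
   its preimage of a face of [G] is a union of orbits of [f']. *)
pose push (B : {set half_edge n}) := [set d | collapse z (mate y2) d \in B].
(* [mate a] precedes the pending edge in its face. *)
have own H H' a b c d : @flipped n H H' a b c ->
  collapse b (mate a) d \in porbit (face_perm H) d.
  move=> flH; rewrite /collapse edge_eqE porbit_sym.
  have fb : face_perm H (mate a) = b.
    by apply/eqP; rewrite face_permE mateK turn_left_eq (flipped_z flH).
  have fmb : face_perm H b = mate b.
    by apply/eqP; rewrite face_permE turn_left_eq (flipped_pending flH).
  case: ifP => [/orP[]/eqP ->|_]; last exact: porbit_id.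
    by rewrite -fb mem_porbit1.
  by have := mem_porbit (face_perm H) 2 (mate a); rewrite permX /= fb fmb.
have pushE e : e.1 != z.1 -> push (porbit f e) = porbit f' e.
  move=> e_out; apply/setP => d; rewrite inE; apply/idP/idP => [de|de].
    have := face_flipped fl de; rewrite !(collapse_out (mate y1)) // => de'.
    have := own _ _ _ _ _ d (flipped_sym fl).
    by rewrite -!eq_porbit_mem => /eqP <-; rewrite eq_porbit_mem.
  by have := face_flipped (flipped_sym fl) de; rewrite (collapse_out _ e).
have faceP i : exists2 e, e.1 != z.1 & boundary i = porbit f e.
  have : boundary i \in porbits f by rewrite -im imset_f.
  move=> /imsetP[e _ ->]; exists (collapse z (mate y1) e) => //.
  by apply/esym/eqP; rewrite eq_porbit_mem (own _ _ _ _ _ _ fl).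
have inj' : injective (push \o boundary).
  move=> i j /= eqij; apply: inj; have [e e_out ei] := faceP i.
  have [e' _ ej] := faceP j.
  have : e \in push (boundary i) by rewrite inE collapse_out // ei porbit_id.
  rewrite eqij inE collapse_out // ei ej -eq_porbit_mem => /eqP -> //.
have im' : [set (push \o boundary) i | i : 'I_s] = porbits f'.
  apply/setP => B; apply/imsetP/imsetP => [[i _ ->]|[d _ ->]] /=.
    by have [e e_out ->] := faceP i; exists e; rewrite ?pushE.
  have : porbit f (collapse z (mate y2) d) \in porbits f by rewrite imset_f.
  rewrite -im => /imsetP[i _ ie]; exists i => //=.
  rewrite -ie pushE //; apply/esym/eqP.
  by rewrite eq_porbit_mem (own _ _ _ _ _ _ (flipped_sym fl)).
exists (fun i => #|[set d in (push \o boundary) i | univalent G' d]|); split.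
  split; first exact: fatgraph_flipped fl fat.
    rewrite (porbits_flipped fl) -chi; congr (_ + _ + _)%N.
    by rewrite -im' -[porbits (face_perm G)]im !card_imset.
  by exists (push \o boundary).
rewrite (sum_boundary _ inj' im') (eq_bigr _ (fun i _ => deltaE i)).
rewrite (sum_boundary _ inj im).
by apply: eq_card => d; rewrite !inE (univalent_flipped fl).
Qed.

(** * Closed paths as sequences of passages *)

Lemma path_stepE n (G : {perm half_edge n}) d d' :
  path_step G d d' =
    if G (mate d) == mate d then d' == mate d
    else (G d' == mate d) || (d' == G (mate d)).
Proof.
rewrite /path_step univalentE /turn_right (eq_sym d' (turn_left _ _)).
by rewrite turn_left_eq (eq_sym (mate d)).
Qed.

Fixpoint walk n (G : {perm half_edge n}) (s : seq (half_edge n))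
    (e : half_edge n) : bool :=
  if s is d :: s' then path_step G d (head e s') && walk G s' e else true.

(** Closed paths are cut into pieces, so a piece [s] is studied together
    with the half-edge [e] that follows it; a closed path is followed by its own
    head. *)
Lemma walk_cycle n (G : {perm half_edge n}) c e :
  path.cycle (path_step G) c = walk G c (head e c).
Proof.
case: c => [//|a s].
suff pathE b t : path (path_step G) b (rcons t a) = walk G (b :: t) a.
  exact: pathE.
by elim: t b => [|b' t IHt] b //=; rewrite IHt.
Qed.

Lemma head_cat T (e : T) s1 s2 : head e (s1 ++ s2) = head (head e s2) s1.
Proof. by case: s1. Qed.

Lemma walk_cat n (G : {perm half_edge n}) s1 s2 e :
  walk G (s1 ++ s2) e = walk G s1 (head e s2) && walk G s2 e.
Proof. by elim: s1 => //= d s1 ->; rewrite head_cat andbA. Qed.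

(** Corresponding passages start alike. The turn that ends a passage depends
    on the start of the next one, so this is what allows passages to be treated
    independently of one another. *)
Lemma flip_head n (y1 z y2 : half_edge n) ps e :
  (forall p, p \in ps -> flip_passage y1 z y2 p) ->
  head e (flatten [seq p.1 | p <- ps]) = head e (flatten [seq p.2 | p <- ps]).
Proof.
case: ps => [//|p ps] /(_ p (mem_head _ _)) [|[d _ ->] //].
by rewrite !inE /= => /or4P[|||/or3P[]] /eqP ->.
Qed.

Lemma edge_out n (y1 z y2 d : half_edge n) :
  d.1 \notin [:: y1.1; z.1; y2.1] -> mate d \notin [:: y1; z; y2].
Proof.
by apply: contra; rewrite !inE => /or3P[] /eqP <-; rewrite eqxx ?orbT.
Qed.

Lemma path_step_flipped n (G G' : {perm half_edge n}) y1 z y2 d d' :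
  flipped G G' y1 z y2 -> mate d \notin [:: y1; z; y2] ->
  path_step G d d' = path_step G' d d'.
Proof.
move=> fl d_out; rewrite /path_step (univalent_flipped fl).
by rewrite (turn_left_flipped fl) // /turn_right (flipped_out fl).
Qed.

Lemma mate_out n (G G' : {perm half_edge n}) y1 z y2 :
  flipped G G' y1 z y2 ->
  (mate y1 \notin [:: y1; z; y2]) * (mate y2 \notin [:: y1; z; y2]).
Proof.
move=> fl; have neq := flipped_neq fl.
by rewrite !inE !(mate_eq, mate_neq, neq).
Qed.

(** Inside a passage the steps are steps of [G'] because a path that arrives
    at a three-valent vertex may leave it through either of the two other
    half-edges, whatever the cyclic order; the last step leaves from a vertex
    where [G] and [G'] agree. *)
Lemma walk_flip_passage n (G G' : {perm half_edge n}) y1 z y2 p e :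
  flipped G G' y1 z y2 -> flip_passage y1 z y2 p ->
  walk G p.1 e -> walk G' p.2 e.
Proof.
move=> fl; have neq := flipped_neq fl; have [m1out m2out] := mate_out fl.
have pz := flipped_pending (flipped_sym fl).
case=> [|[d d_out ->] /=]; last by rewrite (path_step_flipped _ fl) ?edge_out.
have [[e1 e2] ez] := (flipped_y1' fl, flipped_y2' fl, flipped_z' fl).
have s1 := path_step_flipped e fl m1out.
have s2 := path_step_flipped e fl m2out.
rewrite !inE => /or4P[|||/or3P[]] /eqP -> /=; rewrite ?andbT => H; move: H;
  repeat (case/andP=> _); rewrite ?s1 ?s2 => ->;
  by rewrite !path_stepE !mateK !(pz, e1, e2, ez, eqxx, neq, orbT).
Qed.

Lemma walk_flip n (G G' : {perm half_edge n}) y1 z y2 ps e :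
  flipped G G' y1 z y2 -> (forall p, p \in ps -> flip_passage y1 z y2 p) ->
  walk G (flatten [seq p.1 | p <- ps]) e ->
  walk G' (flatten [seq p.2 | p <- ps]) e.
Proof.
move=> fl; elim: ps => //= p ps IHps psP; rewrite !walk_cat => /andP[wp wps].
have psP' q : q \in ps -> flip_passage y1 z y2 q.
  by move=> qps; apply: psP; rewrite inE qps orbT.
rewrite IHps // andbT -(flip_head e psP').
exact: walk_flip_passage fl (psP _ (mem_head _ _)) wp.
Qed.

(** Passages start outside [z, mate z, y1, y2], and this is where a path
    finds itself after leaving the flipped vertex: the half-edges [z, y1, y2]
    are only entered from the flipped vertex, and [mate z] only from its pending
    vertex. *)
Lemma path_step_leave n (G G' : {perm half_edge n}) y1 z y2 d d' :
  flipped G G' y1 z y2 -> d \notin [:: z; mate z; mate y1; mate y2] ->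
  path_step G d d' -> d' \notin [:: z; mate z; y1; y2].
Proof.
move=> fl + dd'; apply: contra.
have Gmd : G (mate d) = d' \/ mate d = G d'.
  move: dd'; rewrite path_stepE.
  by case: eqP => [-> /eqP ->|_ /orP[]/eqP]; auto.
have inG a b : G a = b -> G (mate d) = b -> d = mate a.
  by move=> <- /perm_inj <-; rewrite mateK.
rewrite !inE => /or4P[] /eqP d'E; rewrite {}d'E {dd'} in Gmd.
- case: Gmd => [/(inG _ _ (flipped_y2 fl)) ->|]; first by rewrite eqxx !orbT.
  by rewrite (flipped_z fl) => /(canRL (@mateK n)) ->; rewrite eqxx !orbT.
- case: Gmd => [/(inG _ _ (flipped_pending fl)) ->|].
    by rewrite mateK eqxx.
  by rewrite (flipped_pending fl) => /(canRL (@mateK n)) ->; rewrite mateK eqxx.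
- case: Gmd => [/(inG _ _ (flipped_z fl)) ->|]; first by rewrite eqxx !orbT.
  by rewrite (flipped_y1 fl) => /(canRL (@mateK n)) ->; rewrite eqxx !orbT.
- case: Gmd => [/(inG _ _ (flipped_y1 fl)) ->|]; first by rewrite eqxx !orbT.
  by rewrite (flipped_y2 fl) => /(canRL (@mateK n)) ->; rewrite eqxx !orbT.
Qed.

Lemma path_step_enter n (G G' : {perm half_edge n}) y1 z y2 :
  flipped G G' y1 z y2 ->
  [/\ forall d, path_step G (mate y1) d -> d = z \/ d = y2,
      forall d, path_step G (mate y2) d -> d = z \/ d = y1,
      forall d, path_step G z d -> d = mate z &
      forall d, path_step G (mate z) d -> d = y1 \/ d = y2].
Proof.
move=> fl; have neq := flipped_neq fl; split=> d.
- rewrite path_stepE mateK (flipped_y1 fl) !neq -{1}(flipped_z fl).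
  by rewrite (inj_eq perm_inj) => /orP[] /eqP; [left|right].
- rewrite path_stepE mateK (flipped_y2 fl) !neq -{1}(flipped_y1 fl).
  by rewrite (inj_eq perm_inj) => /orP[] /eqP; [right|left].
- by rewrite path_stepE (flipped_pending fl) eqxx => /eqP.
- rewrite path_stepE mateK (flipped_z fl) !neq -{1}(flipped_y2 fl).
  by rewrite (inj_eq perm_inj) => /orP[] /eqP; [right|left].
Qed.

(** The passage is determined by where the path goes: it either does not
    touch the three edges, or arrives through [mate y1] or [mate y2] and leaves
    through [y1] or [y2], possibly after a visit to the pending edge. *)
Lemma first_passage n (G G' : {perm half_edge n}) y1 z y2 a s e :
  flipped G G' y1 z y2 -> e \notin [:: z; mate z; y1; y2] ->
  a \notin [:: z; mate z; y1; y2] -> walk G (a :: s) e ->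
  exists p t, [/\ flip_passage y1 z y2 p, a :: s = p.1 ++ t, p.1 != [::] &
    head e t \notin [:: z; mate z; y1; y2]].
Proof.
move=> fl e_out a_out /= /andP[a_step ws]; have neq := flipped_neq fl.
have [enter1 enter2 stepz stepmz] := path_step_enter fl.
(* [e] is outside the list, so a piece whose head, with default [e], is in the
   list cannot be empty. *)
have peel b t : head e t = b -> b \in [:: z; mate z; y1; y2] ->
    exists t', t = b :: t'.
  case: t => [|c t] /= cb b_in; last by exists t; rewrite cb.
  by rewrite -cb (negPf e_out) in b_in.
have exit b t : (b == y1) || (b == y2) -> walk G (b :: t) e ->
    head e t \notin [:: z; mate z; y1; y2].
  move=> b12 /andP[bt _]; apply: path_step_leave fl _ bt.
  by case/orP: b12 => /eqP ->; rewrite !inE !(mate_neq, neq).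
have visit : head e s = z -> exists b t,
    [/\ s = [:: z; mate z; b] ++ t, (b == y1) || (b == y2) & walk G (b :: t) e].
  move=> /peel /(_ (mem_head _ _))[s1 s1E].
  move: ws; rewrite s1E /= => /andP[/stepz].
  move=> /peel[|s2 ->]; first by rewrite !inE eqxx orbT.
  move=> /= /andP[/stepmz[/peel[|t ->]|/peel[|t ->]]];
    rewrite ?inE ?eqxx ?orbT //.
    by exists y1, t; rewrite eqxx.
  by exists y2, t; rewrite eqxx orbT.
have [a_in|a_far] := boolP (a.1 \in [:: y1.1; z.1; y2.1]); last first.
  exists ([:: a], [:: a]), s; split=> //; first by right; exists a.
  apply: path_step_leave fl _ a_step; apply: contra a_far.
  by rewrite !inE => /or4P[] /eqP ->; rewrite eqxx ?orbT.
move: a_in a_out; rewrite !inE !edge_eqE => a_in a_out.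
have : (a == mate y1) || (a == mate y2).
  by move: a_in a_out; do 6!case: (a == _).
case/orP => /eqP ae; rewrite {}ae in a_step *;
  [case: (enter1 _ a_step)|case: (enter2 _ a_step)].
- move=> /visit[b [t [-> b12 wt]]].
  case/orP: (b12) => /eqP bE; rewrite {}bE in b12 wt *.
    exists ([:: mate y1; z; mate z; y1], [:: mate y1; z; mate z; y1]), t.
    by split; rewrite ?(exit _ _ b12 wt) //; left; rewrite !inE eqxx !orbT.
  exists ([:: mate y1; z; mate z; y2], [:: mate y1; y2]), t.
  by split; rewrite ?(exit _ _ b12 wt) //; left; rewrite !inE eqxx ?orbT.
- move=> /peel[|t tE]; first by rewrite !inE eqxx !orbT.
  rewrite tE in ws *; exists ([:: mate y1; y2], [:: mate y1; z; mate z; y2]), t.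
  split=> //; last by rewrite (exit _ _ _ ws) // eqxx orbT.
  by left; rewrite !inE eqxx !orbT.
- move=> /visit[b [t [-> b12 wt]]].
  case/orP: (b12) => /eqP bE; rewrite {}bE in b12 wt *.
    exists ([:: mate y2; z; mate z; y1], [:: mate y2; y1]), t.
    by split; rewrite ?(exit _ _ b12 wt) //; left; rewrite !inE eqxx ?orbT.
  exists ([:: mate y2; z; mate z; y2], [:: mate y2; z; mate z; y2]), t.
  by split; rewrite ?(exit _ _ b12 wt) //; left; rewrite !inE eqxx !orbT.
- move=> /peel[|t tE]; first by rewrite !inE eqxx !orbT.
  rewrite tE in ws *; exists ([:: mate y2; y1], [:: mate y2; z; mate z; y1]), t.
  split=> //; last by rewrite (exit _ _ _ ws) // eqxx.
  by left; rewrite !inE eqxx !orbT.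
Qed.

Lemma walk_passages n (G G' : {perm half_edge n}) y1 z y2 s e :
  flipped G G' y1 z y2 -> e \notin [:: z; mate z; y1; y2] ->
  head e s \notin [:: z; mate z; y1; y2] -> walk G s e ->
  exists2 ps : seq (seq (half_edge n) * seq (half_edge n)),
    forall p, p \in ps -> flip_passage y1 z y2 p &
    s = flatten [seq p.1 | p <- ps].
Proof.
move=> fl e_out; have [m] := ubnP (size s).
elim: m s => // m IHm [|a s] sm hd ws.
  by exists [::].
have [p [t [pP st p1 ht]]] := first_passage fl e_out hd ws.
rewrite st in ws sm *; have [||ps psP ->] := IHm t _ ht.
- move: sm p1; case: (p.1) => //= d u; rewrite size_cat ltnS => + _.
  by apply: leq_trans; rewrite ltnS leq_addl.
- by move: ws; rewrite walk_cat => /andP[].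
by exists (p :: ps) => // q; rewrite inE => /predU1P[->|/psP].
Qed.

(** A closed path has to be rotated so that it starts with a whole passage.
    This is possible because [z] is followed by [mate z], [mate z] by [y1] or
    [y2], and these by the start of a passage. *)
Lemma corresponding_path_exists n (G G' : {perm half_edge n}) y1 z y2 c :
  flipped G G' y1 z y2 -> closed_path G c ->
  exists c', corresponding_path y1 z y2 c c'.
Proof.
move=> fl /andP[c0 cyc]; have neq := flipped_neq fl.
have [enter1 enter2 stepz stepmz] := path_step_enter fl.
have [/hasP[e ec e_out]|/hasPn all_in] :=
    boolP (has (fun d => d \notin [:: z; mate z; y1; y2]) c); last first.
  have nxt d : d \in c -> exists2 d', d' \in c & path_step G d d'.
    by move=> dc; exists (next c d); rewrite ?mem_next // next_cycle.
  have notin d : d \in c -> (d == y1) || (d == y2) -> False.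
    move=> dc d12; have [d' d'c /(path_step_leave fl)] := nxt d dc.
    move=> /(_ _)/negP; apply; last by have /negPn := all_in _ d'c.
    by case/orP: d12 => /eqP ->; rewrite !inE !(mate_neq, neq).
  have notmz : mate z \notin c.
    apply/negP => /nxt[d dc /stepmz d12]; apply: (notin d dc).
    by case: d12 => ->; rewrite eqxx ?orbT.
  have notz : z \notin c.
    by apply/negP => /nxt[d dc /stepz de]; rewrite -de dc in notmz.
  case: c c0 all_in notin notmz notz {cyc nxt} => // d c _ + notin notmz notz.
  move=> /(_ d (mem_head _ _)) /negPn; rewrite !inE.
  case/or4P => /eqP de.
  - by rewrite de mem_head in notz.
  - by rewrite de mem_head in notmz.
  - by case: (notin d (mem_head _ _)); rewrite de eqxx.
  - by case: (notin d (mem_head _ _)); rewrite de eqxx orbT.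
have [i s rotE] := rot_to ec.
have [||ps psP sE] := walk_passages (s := e :: s) fl e_out.
- exact: e_out.
- by have := walk_cycle G (e :: s) e; rewrite -{1}rotE rot_cycle cyc => <-.
exists (flatten [seq p.2 | p <- ps]), ps, (size (rot i c) - i)%N, 0%N.
split=> //.
  by rewrite -sE -rotE -/(rotr i (rot i c)) rotK.
by rewrite rot0.
Qed.

(** * Holonomy and geodesic functions *)

Lemma turn_mxE (R : realType) n (G : {perm half_edge n}) d d' :
  turn_mx R G d d' =
    if G (mate d) == mate d then mxF R
    else if G d' == mate d then mxL R else mxR R.
Proof.
by rewrite /turn_mx univalentE (eq_sym d') turn_left_eq (eq_sym (mate d)).
Qed.

Lemma turn_mx_flipped (R : realType) n (G G' : {perm half_edge n})
    y1 z y2 d d' :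
  flipped G G' y1 z y2 -> mate d \notin [:: y1; z; y2] ->
  turn_mx R G d d' = turn_mx R G' d d'.
Proof.
move=> fl d_out; rewrite /turn_mx (univalent_flipped fl).
by rewrite (turn_left_flipped fl).
Qed.

(** The product of the turn and edge matrices along the piece [s] of a path;
    the half-edge [e] that follows [s] determines the last turn. *)
Fixpoint holonomy (R : realType) n (G : {perm half_edge n}) (x : 'rV[R]_n)
    (s : seq (half_edge n)) (e : half_edge n) : 'M[R]_2 :=
  if s is d :: s'
  then holonomy G x s' e * (turn_mx R G d (head e s') * mxX (x 0 d.1))
  else 1.

Lemma geodesic_fun_holonomy (R : realType) n (G : {perm half_edge n})
    (x : 'rV[R]_n) c e :
  geodesic_fun G x c = \tr (holonomy G x c (head e c)).
Proof.
case: c => [|a s]; first by rewrite /geodesic_fun big_nil.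
rewrite /geodesic_fun rot1_cons /=; congr (\tr _).
suff prodE b t : \prod_(w <- rev (zip (b :: t) (rcons t a)))
    (turn_mx R G w.1 w.2 * mxX (x 0 w.1.1)) = holonomy G x (b :: t) a.
  exact: prodE.
elim: t b => [|b' t IHt] b; first by rewrite /= big_cons big_nil mulr1 mul1r.
by rewrite /= rev_cons -cats1 big_cat big_seq1 IHt.
Qed.

Lemma holonomy_cat (R : realType) n (G : {perm half_edge n}) (x : 'rV[R]_n)
    s1 s2 e :
  holonomy G x (s1 ++ s2) e = holonomy G x s2 e * holonomy G x s1 (head e s2).
Proof.
by elim: s1 => [|d s1 IHs] /=; rewrite ?mulr1 // IHs head_cat !mulrA.
Qed.

(** Rotating a closed path exchanges the two factors of its holonomy, and
    the trace is cyclic. *)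
Lemma geodesic_fun_rot (R : realType) n (G : {perm half_edge n})
    (x : 'rV[R]_n) i c :
  geodesic_fun G x (rot i c) = geodesic_fun G x c.
Proof.
rewrite -{2}(cat_take_drop i c) /rot.
case: (take i c) (drop i c) => [|a s] [|b t]; rewrite ?cats0 //.
rewrite !(geodesic_fun_holonomy _ _ _ a) !holonomy_cat /=.
exact: mxtrace_mulC.
Qed.

Lemma mx22M (R : realType) (a b c d a' b' c' d' : R) :
  mx22 a b c d * mx22 a' b' c' d' =
  mx22 (a * a' + b * c') (a * b' + b * d') (c * a' + d * c') (c * b' + d * d').
Proof.
apply/matrixP => i j; rewrite !mxE !big_ord_recl big_ord0 addr0 !mxE.
by case: i j => [[|[|[]]] //= _] [[|[|[]]] //= _].
Qed.

Lemma mxXE (R : realType) (Z : R) :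
  mxX Z = mx22 0 (- expR (Z / 2)) (expR (Z / 2))^-1 0.
Proof. by rewrite /mxX expRN. Qed.

(** The part of a passage between the two other edges, when it visits the
    pending edge. With [s = e^(Z/2)] the entries [u] and [v] are [e^Z] and
    [e^(-Z)], since the product [X F X] at [Z] is again an [X], at [2 Z]. *)
Lemma turn_around_mx (R : realType) (s : R) : s != 0 ->
  let X : 'M[R]_2 := mx22 0 (- s) s^-1 0 in
  let around A (B : 'M[R]_2) := A * X * mxF R * X * B in
  let L := mxL R in let P := mxR R in let u := s * s in let v := s^-1 * s^-1 in
  [/\ around L L = mx22 0 v (- u) (- (u + v)),
      around P P = mx22 (u + v) v (- u) 0,
      around P L = mx22 u (u + v) (- u) (- u) &
      around L P = mx22 v v (- (u + v)) (- v)].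
Proof.
by move=> s0 /=; rewrite /mxL /mxR /mxF !mx22M; split; congr mx22; field.
Qed.

Lemma edge_conj_mx (R : realType) (p q m11 m12 m21 m22 : R) :
  p != 0 -> q != 0 ->
  mx22 0 (- p) p^-1 0 * mx22 m11 m12 m21 m22 * mx22 0 (- q) q^-1 0 =
  mx22 (- (p * m22 / q)) (p * m21 * q) (m12 / (p * q)) (- (m11 * q / p)).
Proof.
by move=> p0 q0; rewrite !mx22M; congr mx22; field; rewrite ?p0 ?q0.
Qed.

(** The six passages, with [a, b, c] the exponentials of half of
    [Z, Y1, Y2]. After the flip these are [a^-1], [b'] and [c']. One has
    [b' c' = b c a^2] and [c' / b' = (c / b) (a^2 + a^-2)], and these are the
    combinations that occur in the entries. *)
Lemma passage_products (R : realType) (a b c w : R) :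
  a != 0 -> b != 0 -> c != 0 -> w != 0 -> w * w = 1 + a ^+ 4 ->
  let X t : 'M[R]_2 := mx22 0 (- t) t^-1 0 in
  let visit p A s B q : 'M[R]_2 := X p * A * X s * mxF R * X s * B * X q in
  let L := mxL R in let P := mxR R in
  let b' := b * a * a / w in let c' := c * w in
  [/\ visit c L a L b = X c' * L * X b',
      visit b P a P c = X b' * P * X c',
      X c * P * X b = visit c' P a^-1 P b',
      X b * L * X c = visit b' L a^-1 L c' &
      visit b P a L b = visit b' L a^-1 P b' /\
      visit c L a P c = visit c' P a^-1 L c'].
Proof.
move=> a0 b0 c0 w0 ww X visit L P b' c'.
have ai0 : a^-1 != 0 by rewrite invr_neq0.
have b'0 : b' != 0 by rewrite !mulf_neq0 ?invr_neq0.
have c'0 : c' != 0 by rewrite mulf_neq0.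
have visitE p A s B q :
    visit p A s B q = X p * (A * X s * mxF R * X s * B) * X q.
  by rewrite /visit !mulrA.
have [LL PP PL LP] := turn_around_mx a0.
have [LLi PPi PLi LPi] := turn_around_mx ai0.
rewrite !visitE /L /P LL PP PL LP LLi PPi PLi LPi /mxL /mxR /X !edge_conj_mx //.
by split; [| | | |split]; congr mx22; rewrite /b' /c'; field: ww;
  rewrite ?a0 ?b0 ?c0 ?w0.
Qed.

(** Both logarithms are expressed by [l = ln (1 + e^(2Z))], because
    [1 + e^(-2Z) = e^(-2Z) (1 + e^(2Z))]; the three coordinates then depend on
    [Z] through a single non-linear function. *)
Lemma flip_coordE (R : realType) n (y1 z y2 : 'I_n) (x : 'rV[R]_n) j :
  let l := ln (1 + expR (2 * x 0 z)) in
  flip_coord y1 z y2 x 0 j =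
    if j == y1 then x 0 y1 + 2 * x 0 z - l
    else if j == y2 then x 0 y2 + l
    else if j == z then - x 0 z else x 0 j.
Proof.
move=> l; have expl : expR l = 1 + expR (2 * x 0 z).
  by rewrite lnK // posrE addr_gt0 ?expR_gt0.
rewrite !mxE -expl -expRD expRK.
have -> : 1 + expR (- (2 * x 0 z)) = expR (l - 2 * x 0 z).
  by rewrite expRD expl (mulrDl 1 (expR _)) mul1r expRxMexpNx_1 addrC.
by rewrite -expRN -expRD expRK opprB addrA.
Qed.

(** Away from the three edges nothing changes. In the six other passages the
    last turn is the same on both sides, so it factors out, and the rest is one
    of the identities [passage_products]. *)
Lemma holonomy_flip_passage (R : realType) n (G G' : {perm half_edge n})
    y1 z y2 (x : 'rV[R]_n) p e :
  flipped G G' y1 z y2 -> flip_passage y1 z y2 p ->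
  holonomy G x p.1 e = holonomy G' (flip_coord y1.1 z.1 y2.1 x) p.2 e.
Proof.
move=> fl; have neq := flipped_neq fl; have [m1out m2out] := mate_out fl.
set x' := flip_coord _ _ _ _; pose l := ln (1 + expR (2 * x 0 z.1)).
have expl : expR l = 1 + expR (2 * x 0 z.1).
  by rewrite lnK // posrE addr_gt0 ?expR_gt0.
have half (u : R) : expR (u / 2) * expR (u / 2) = expR u.
  by rewrite -expRD; congr expR; field.
set a := expR (x 0 z.1 / 2); set b := expR (x 0 y1.1 / 2).
set c := expR (x 0 y2.1 / 2); set w := expR (l / 2).
have ww : w * w = 1 + a ^+ 4.
  by rewrite half expl -[4%N]/(2 * 2)%N exprM [a ^+ 2]expr2 /a half -expRM_natl.
have x1 : expR (x' 0 y1.1 / 2) = b * a * a / w.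
  have -> : x' 0 y1.1 / 2 = x 0 y1.1 / 2 + x 0 z.1 / 2 + x 0 z.1 / 2 - l / 2.
    by rewrite flip_coordE eqxx /= -/l; field.
  by rewrite !expRD expRN.
have x2 : expR (x' 0 y2.1 / 2) = c * w.
  by rewrite flip_coordE edge_eqE !(mate_eq, neq) eqxx mulrDl expRD.
have xz : expR (x' 0 z.1 / 2) = a^-1.
  by rewrite flip_coordE !edge_eqE !(mate_eq, neq) eqxx mulNr expRN.
have [] := @passage_products R a b c w;
  rewrite ?gt_eqF ?expR_gt0 //= -/a -/b -/c -/w.
move=> prod1 prod2 prod3 prod4 [prod5 prod6].
case=> [|[d d_out ->] /=]; last first.
  rewrite (turn_mx_flipped _ _ fl) ?edge_out //.
  move: d_out; rewrite !inE !negb_or => /and3P[/negPf d1 /negPf dz /negPf d2].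
  by rewrite /x' flip_coordE d1 d2 dz.
have t1 := turn_mx_flipped R e fl m1out.
have t2 := turn_mx_flipped R e fl m2out.
have [pz pz'] := (flipped_pending fl, flipped_pending (flipped_sym fl)).
have [[e1 e2] ez] := (flipped_y1 fl, flipped_y2 fl, flipped_z fl).
have [[e1' e2'] ez'] := (flipped_y1' fl, flipped_y2' fl, flipped_z' fl).
have turns :
    ((turn_mx R G (mate y1) z = mxL R) * (turn_mx R G (mate y1) y2 = mxR R) *
     (turn_mx R G (mate y2) z = mxR R) * (turn_mx R G (mate y2) y1 = mxL R) *
     (turn_mx R G (mate z) y1 = mxR R) * (turn_mx R G (mate z) y2 = mxL R) *
     (turn_mx R G z (mate z) = mxF R))%type.
  by rewrite !turn_mxE !mateK !(pz, e1, e2, ez, eqxx, neq).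
have turns' :
    ((turn_mx R G' (mate y1) z = mxR R) * (turn_mx R G' (mate y1) y2 = mxL R) *
     (turn_mx R G' (mate y2) z = mxL R) * (turn_mx R G' (mate y2) y1 = mxR R) *
     (turn_mx R G' (mate z) y1 = mxL R) * (turn_mx R G' (mate z) y2 = mxR R) *
     (turn_mx R G' z (mate z) = mxF R))%type.
  by rewrite !turn_mxE !mateK !(pz', e1', e2', ez', eqxx, neq).
rewrite !inE => /or4P[|||/or3P[]] /eqP -> /=;
  rewrite !mul1r ?t1 ?t2 !turns ?turns' -!mulrA;
  apply: (congr1 (fun M => turn_mx R G' _ e * M));
  by rewrite !mxXE !(x1, x2, xz) !mulrA.
Qed.

Lemma holonomy_flip (R : realType) n (G G' : {perm half_edge n})
    y1 z y2 (x : 'rV[R]_n) ps e :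
  flipped G G' y1 z y2 -> (forall p, p \in ps -> flip_passage y1 z y2 p) ->
  holonomy G x (flatten [seq p.1 | p <- ps]) e =
  holonomy G' (flip_coord y1.1 z.1 y2.1 x) (flatten [seq p.2 | p <- ps]) e.
Proof.
move=> fl; elim: ps => //= p ps IHps psP.
have psP' q : q \in ps -> flip_passage y1 z y2 q.
  by move=> qps; apply: psP; rewrite inE qps orbT.
rewrite !holonomy_cat IHps // (flip_head _ psP').
by rewrite (holonomy_flip_passage _ _ fl (psP _ (mem_head _ _))).
Qed.

(** The turn that closes the path up is taken into account because the two
    paths have the same head. *)
Lemma corresponding_path_flip (R : realType) n (G G' : {perm half_edge n})
    y1 z y2 c c' :
  flipped G G' y1 z y2 -> closed_path G c -> corresponding_path y1 z y2 c c' ->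
  closed_path G' c' /\
  forall x : 'rV[R]_n,
    geodesic_fun G x c = geodesic_fun G' (flip_coord y1.1 z.1 y2.1 x) c'.
Proof.
move=> fl + [ps [i [j [psP cE c'E]]]].
rewrite cE c'E {c cE c' c'E} /closed_path !rot_cycle.
set s1 := flatten _; set s2 := flatten _.
have hd e : head e s1 = head e s2 by exact: flip_head _ psP.
rewrite -!size_eq0 !size_rot => /andP[s1_neq0 cyc]; split=> [|x].
  apply/andP; split.
    case: s2 s1 hd s1_neq0 {cyc} => // -[//|a s1] /(_ (mate a)) /esym /eqP.
    by rewrite eq_sym mate_neq.
  rewrite (walk_cycle _ _ y1) -hd; apply: walk_flip fl psP _.
  by rewrite -walk_cycle.
rewrite !geodesic_fun_rot !(geodesic_fun_holonomy _ _ _ y1) -hd.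
by rewrite (holonomy_flip _ _ fl psP).
Qed.

(** * Smoothness of the coordinate change *)

Lemma is_diff_coord (R : realType) n (x : 'rV[R]_n) j :
  is_diff x (fun N : 'rV[R]_n => N 0 j) (fun N => N 0 j).
Proof.
apply: DiffDef; first exact: differentiable_coord.
have @f : {linear 'rV[R]_n -> R}.
  by exists (fun N : 'rV[R]_n => N 0 j); do 2![eexists]; do ?[constructor];
     rewrite ?mxE// => ? *; rewrite ?mxE//; move=> ?; rewrite !mxE.
rewrite (_ : (fun _ => _) = f) //; exact/diff_lin/coord_continuous.
Qed.

Lemma is_diff_coord_add (R : realType) n (x : 'rV[R]_n) (k : R) j z
    (g : R -> R) dg :
  is_derive (x 0 z) 1 g dg ->
  is_diff x (fun N : 'rV[R]_n => k * N 0 j + g (N 0 z))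
            (fun v => k * v 0 j + v 0 z * dg).
Proof.
move=> gd.
have gdiff : is_diff (x 0 z) g ( *:%R^~ dg).
  apply: DiffDef; first exact/derivable1_diffP.
  by rewrite deriv1E // derive1E derive_val.
have := is_diff_comp (is_diff_coord x z) gdiff.
have := is_diffZ k (is_diff_coord x j).
exact: is_diffD.
Qed.

Lemma smooth_closed (R : realType) n (K : ('rV[R]_n -> R) -> Prop) :
  (forall f x, K f -> differentiable f x) ->
  (forall f i, K f -> K (partial i f)) ->
  forall f, K f -> smooth f.
Proof.
move=> Kd Kp f Kf s x; apply: Kd; elim: s => //= i s; exact: Kp.
Qed.

Definition fermi (R : realType) (t : R) := (1 + expR (2 * t))^-1.

(** The functions of [Z] that appear in the flip and in its derivatives of
    all orders. The polynomial part is needed for stability, since the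
    derivative of [fermi] is [- 2 (fermi - fermi^2)]. *)
Definition fermi_family (R : realType) (a c : R) (p : {poly R}) (t : R) : R :=
  a * t + c * ln (1 + expR (2 * t)) + p.[fermi t].

Lemma is_derive_fermi_family (R : realType) (a c : R) p (t : R) :
  is_derive t 1 (fermi_family a c p)
   ((a%:P + (c *+ 2) *: (1 - 'X) - (p^`() * ('X - 'X^2)) *+ 2).[fermi t]).
Proof.
have e0 : 0 < 1 + expR (2 * t) by rewrite addr_gt0 ?expR_gt0.
have d2 : is_derive t 1 (fun t : R => 2 * t) 2.
  by apply: is_derive_eq; rewrite /= scaler1.
have de : is_derive t 1 (fun t : R => 1 + expR (2 * t)) (expR (2 * t) * 2).
  have := is_deriveD (is_derive_cst (1 : R) t 1)
    (is_derive1_comp (is_derive_expR _) d2).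
  by rewrite add0r.
have dl : is_derive t 1 (fun t => ln (1 + expR (2 * t))) (2 * (1 - fermi t)).
  have H : is_derive t 1 (fun t => ln (1 + expR (2 * t))) _ :=
    is_derive1_comp (f := @ln R) (g := fun t => 1 + expR (2 * t)) (x := t)
      (is_derive1_ln e0) de.
  apply: is_derive_eq H _.
  by rewrite /fermi; field; rewrite gt_eqF.
have ds : is_derive t 1 (@fermi R) (- 2 * (fermi t - fermi t ^+ 2)).
  have H : is_derive t 1 (@fermi R) _ :=
    is_deriveV (f := fun t => 1 + expR (2 * t)) (lt0r_neq0 e0) de.
  apply: is_derive_eq H _.
  by rewrite /fermi /GRing.scale /=; field; rewrite gt_eqF.
have dp := is_derive1_comp (is_derive_poly p (fermi t)) ds.
have H : is_derive t 1 (fermi_family a c p) _ :=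
  is_deriveD (is_deriveD (is_deriveZ a (is_derive_id t 1)) (is_deriveZ c dl))
    dp.
apply: is_derive_eq H _.
rewrite !(hornerE, hornerMn) /GRing.scale /=.
ring.
Qed.

Lemma partialE (R : realType) n (f df : 'rV[R]_n -> R) i x :
  is_diff x f df -> partial i f x = df (delta_mx 0 i).
Proof. by move=> fdf; rewrite /partial deriveE // diff_val. Qed.

(** The chain rule. The differential of [phi] exists since [phi] is a finite
    sum of its coordinates times basis vectors. *)
Lemma partial_comp (R : realType) n m (phi : 'rV[R]_n -> 'rV[R]_m)
    (f : 'rV[R]_m -> R) i x :
  (forall j, differentiable (fun x => phi x 0 j) x) ->
  differentiable f (phi x) ->
  partial i (f \o phi) x =
  \sum_j partial i (fun x => phi x 0 j) x * partial j f (phi x).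
Proof.
move=> dphi df; have dPhi : differentiable phi x.
  rewrite (_ : phi = \sum_(j < m) (fun x => phi x 0 j *: delta_mx 0 j)).
    by apply: differentiable_sum => j; apply: differentiableZl.
  by apply/funext => N; rewrite fct_sumE -row_sum_delta.
rewrite /partial deriveE; last exact: differentiable_comp.
rewrite diff_comp //= -(deriveE (delta_mx 0 i) dPhi) derive_mx;
  last exact: diff_derivable.
rewrite [X in 'd f _ X]row_sum_delta linear_sum; apply: eq_bigr => j _.
by rewrite linearZ /= mxE (deriveE _ df).
Qed.

Lemma smooth_fermi_family (R : realType) n (k a c : R) p (j z : 'I_n) :
  smooth (fun x : 'rV[R]_n => k * x 0 j + fermi_family a c p (x 0 z)).
Proof.
pose K (f : 'rV[R]_n -> R) := exists k a c p,
  f = fun x => k * x 0 j + fermi_family a c p (x 0 z).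
apply: (@smooth_closed _ _ K); last by exists k, a, c, p.
  move=> _ x [{}k [{}a [{}c [{}p ->]]]].
  by have [] := is_diff_coord_add k j (is_derive_fermi_family a c p (x 0 z)).
move=> _ i [{}k [{}a [{}c [{}p ->]]]].
set q := a%:P + (c *+ 2) *: (1 - 'X) - (p^`() * ('X - 'X^2)) *+ 2.
exists 0, 0, 0, ((k * (i == j)%:R)%:P + (i == z)%:R *: q).
apply/funext => x.
have df := is_derive_fermi_family a c p (x 0 z).
rewrite (partialE _ (is_diff_coord_add k j df)).
rewrite /fermi_family !mxE !eqxx /= -/q !hornerE.
by rewrite !(eq_sym i) /= !add0r.
Qed.

Lemma flip_coord_fermi_family (R : realType) n (y1 z y2 j : 'I_n) :
  let: (k, a, c) := if j == y1 then (1, 2, -1) else if j == y2 then (1, 0, 1)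
    else if j == z then (0, -1, 0) else (1, 0, 0) in
  (fun x : 'rV[R]_n => flip_coord y1 z y2 x 0 j) =
  (fun x => k * x 0 j + fermi_family a c 0 (x 0 z)).
Proof.
have fE x := @flip_coordE R n y1 z y2 x j.
case: (eqVneq j y1) fE => [->|_] fE; last case: (eqVneq j y2) fE => [->|_] fE;
  last case: (eqVneq j z) fE => [->|_] fE;
  by apply/funext => x; rewrite fE /fermi_family horner0 /=; ring.
Qed.

Lemma smooth_flip_coord (R : realType) n (y1 z y2 : 'I_n) :
  smooth_map (@flip_coord R n y1 z y2).
Proof.
move=> j; have := flip_coord_fermi_family R y1 z y2 j.
by case: (if _ then _ else _) => [[k a] c] ->; apply: smooth_fermi_family.
Qed.

(** The identity plus a correction in the direction of [z]; writing it with
    Kronecker symbols makes the sum in the chain rule immediate. The term [- 2]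
    turns the diagonal entry [1] of [z] into [- 1]. *)
Lemma partial_flip_coord (R : realType) n (y1 z y2 : 'I_n) i j (x : 'rV[R]_n) :
  uniq [:: y1; z; y2] ->
  partial i (fun x => flip_coord y1 z y2 x 0 j) x =
  (j == i)%:R + (z == i)%:R * (2 * fermi (x 0 z) * (j == y1)%:R
    + 2 * (1 - fermi (x 0 z)) * (j == y2)%:R - 2 * (j == z)%:R).
Proof.
rewrite /= !inE negb_or andbT => /andP[/andP[n1z n12] nz2].
have := flip_coord_fermi_family R y1 z y2 j.
set kac := (if _ then _ else _); move: (erefl kac); rewrite {2}/kac.
case: kac => [[k a] c] kacE ->.
have df := is_derive_fermi_family a c 0 (x 0 z).
rewrite (partialE _ (is_diff_coord_add k j df)).
rewrite !mxE !eqxx deriv0 mul0r mul0rn subr0 !hornerE /=.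
have [jE|] := eqVneq j y1.
  rewrite jE eqxx (negPf n1z) (negPf n12) in kacE *.
  by case: kacE => -> -> ->; rewrite /=; ring.
have [jE _|/negPf j2 /negPf j1] := eqVneq j y2.
  rewrite jE eqxx (eq_sym y2 y1) (negPf n12) in kacE *.
  rewrite (eq_sym y2 z) (negPf nz2) in kacE *.
  by case: kacE => -> -> ->; rewrite /=; ring.
rewrite j1 j2 in kacE; have [jz|/negPf jz] := eqVneq j z; last first.
  by rewrite jz in kacE; case: kacE => -> -> ->; rewrite /=; ring.
rewrite jz eqxx in kacE *; case: kacE => -> -> ->.
by case: eqVneq => _ /=; ring.
Qed.

Lemma partial_comp_flip_coord (R : realType) n (y1 z y2 : 'I_n) i
    (x : 'rV[R]_n) f :
  uniq [:: y1; z; y2] -> (forall x, differentiable f x) ->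
  let phi := @flip_coord R n y1 z y2 in let s := fermi (x 0 z) in
  partial i (f \o phi) x = partial i f (phi x) + (z == i)%:R *
    (2 * s * partial y1 f (phi x) + 2 * (1 - s) * partial y2 f (phi x)
     - 2 * partial z f (phi x)).
Proof.
move=> uq df phi s; rewrite partial_comp //; last first.
  by move=> j; apply: (smooth_flip_coord _ _ _ _ [::]).
under eq_bigr do rewrite (partial_flip_coord _ _ _ uq) -/s.
have pick (w : 'I_n -> R) k : \sum_j (j == k)%:R * w j = w k.
  rewrite (bigD1 k) //= eqxx mul1r big1 ?addr0 // => j /negPf ->.
  by rewrite mul0r.
pose w j := partial j f (phi x).
rewrite -!/(w _) -(pick w i) -(pick w y1) -(pick w y2) -(pick w z) !mulr_sumr.
rewrite -!big_split -sumrB mulr_sumr -big_split /=.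
by apply: eq_bigr => j _; rewrite /w; ring.
Qed.

(** * The Poisson bracket *)

Lemma poisson_bracket_trivalent (R : realType) n (G : {perm half_edge n})
    (f h : 'rV[R]_n -> R) x :
  poisson_bracket G f h x =
  \sum_(d | trivalent G d)
    (partial d.1 f x * partial (G d).1 h x
     - partial (G d).1 f x * partial d.1 h x).
Proof.
have := big_porbits +%R G (fun v => #|v| == 3%N) predT (fun d =>
  partial d.1 f x * partial (G d).1 h x
  - partial (G d).1 f x * partial d.1 h x).
rewrite /poisson_bracket.
under [LHS]eq_bigr do under eq_bigl do rewrite andbT.
by move=> ->; apply: eq_bigl => d; rewrite andbT.
Qed.

(** Away from the flipped vertex no half-edge belongs to the pending edge,
    so the terms are equal one by one. At the flipped vertex the identity is
    polynomial in the derivatives; it uses that the coefficients [2 s] and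
    [2 (1 - s)] add up to [2]. *)
Lemma poisson_bracket_flip (R : realType) n (G G' : {perm half_edge n})
    y1 z y2 (f h : 'rV[R]_n -> R) x :
  flipped G G' y1 z y2 -> trivalent G y1 ->
  (forall x, differentiable f x) -> (forall x, differentiable h x) ->
  let phi := @flip_coord R n y1.1 z.1 y2.1 in
  poisson_bracket G (f \o phi) (h \o phi) x = poisson_bracket G' f h (phi x).
Proof.
move=> fl tri1 df dh phi; have neq := flipped_neq fl.
have uq : uniq [:: y1.1; z.1; y2.1].
  by rewrite /= !inE !edge_eqE !(mate_eq, mateK, neq).
have dE u i : (forall x, differentiable u x) -> i != z.1 ->
    partial i (u \o phi) x = partial i u (phi x).
  move=> du iz; rewrite partial_comp_flip_coord // eq_sym (negPf iz).
  by rewrite mul0r addr0.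
have dzE u : (forall x, differentiable u x) ->
    partial z.1 (u \o phi) x = partial z.1 u (phi x) +
      (2 * fermi (x 0 z.1) * partial y1.1 u (phi x) +
       2 * (1 - fermi (x 0 z.1)) * partial y2.1 u (phi x) -
       2 * partial z.1 u (phi x)).
  by move=> du; rewrite partial_comp_flip_coord // eqxx mul1r.
have tri_orbit d : trivalent G (G d) = trivalent G d.
  by have := porbit_perm G 1 d; rewrite /trivalent expg1 => ->.
have tri2 : trivalent G y2 by rewrite -(flipped_y1 fl) tri_orbit.
have triz : trivalent G z by rewrite -(flipped_y2 fl) tri_orbit.
have y1z : y1.1 != z.1 by rewrite edge_eqE !neq.
have y2z : y2.1 != z.1 by rewrite edge_eqE !neq.
rewrite !poisson_bracket_trivalent.
rewrite (bigD1 y1) //= (bigD1 y2) /=; last by rewrite tri2 neq.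
rewrite (bigD1 z) /=; last by rewrite triz !neq.
have tri' : trivalent G' =1 trivalent G.
  by move=> d; rewrite /trivalent (porbit_flipped fl).
rewrite [RHS](eq_bigl _ _ tri') [in RHS](bigD1 y1) //= [in RHS](bigD1 y2) /=;
  last by rewrite tri2 neq.
rewrite [in RHS](bigD1 z) /=; last by rewrite triz !neq.
rewrite (flipped_y1 fl) (flipped_y2 fl) (flipped_z fl).
rewrite (flipped_y1' fl) (flipped_y2' fl) (flipped_z' fl).
have regroup (a b c d a' b' c' d' : R) : d = d' -> a + b + c = a' + b' + c' ->
    a + (b + (c + d)) = a' + (b' + (c' + d')).
  by rewrite !addrA => -> ->.
apply: regroup.
  apply: eq_bigr => d /andP[/andP[/andP[trid d1] d2] dz].
  have d_out : d \notin [:: y1; z; y2] by rewrite !inE !negb_or d1 d2 dz.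
  have not_mz e : trivalent G e -> e != mate z.
    apply: contraTneq => ->; rewrite /trivalent.
    by have /eqP := flipped_pending fl; rewrite -univalentE => /eqP ->.
  have Gdz : (G d).1 != z.1.
    rewrite edge_eqE negb_or not_mz ?tri_orbit // andbT.
    by rewrite -(flipped_y2 fl) (inj_eq perm_inj).
  have dz1 : d.1 != z.1 by rewrite edge_eqE negb_or dz not_mz.
  rewrite (flipped_out fl d_out) (dE f _ df dz1) (dE h _ dh dz1).
  by rewrite (dE f _ df Gdz) (dE h _ dh Gdz).
rewrite (dE f y1.1 df y1z) (dE h y1.1 dh y1z) (dE f y2.1 df y2z).
rewrite (dE h y2.1 dh y2z) (dzE f df) (dzE h dh).
have vertex (f1 f2 fz h1 h2 hz t : R) :
    let Fz := fz + (2 * t * f1 + 2 * (1 - t) * f2 - 2 * fz) in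
    let Hz := hz + (2 * t * h1 + 2 * (1 - t) * h2 - 2 * hz) in
    (f1 * h2 - f2 * h1) + (f2 * Hz - Fz * h2) + (Fz * h1 - f1 * Hz) =
    (f1 * hz - fz * h1) + (f2 * h1 - f1 * h2) + (fz * h2 - f2 * hz).
  by move=> /=; ring.
exact: vertex.
Qed.

(** * Invariance under the flip *)

Theorem lemma3 (R : realType) (n : nat) (G G' : {perm half_edge n})
    (g s : nat) (delta1 : 'I_s -> nat) (y1 z y2 : half_edge n)
    (hG : is_spine G g delta1)
    (hz : pending_at G y1 z y2)
    (hG' : pending_flip G G' y1 z y2) :
  let phi := @flip_coord R n y1.1 z.1 y2.1 in
  [/\ exists delta2 : 'I_s -> nat,
        is_spine G' g delta2 /\
        (\sum_(i < s) delta2 i)%N = (\sum_(i < s) delta1 i)%N,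
      smooth_map phi,
      forall f h : 'rV[R]_n -> R, smooth f -> smooth h ->
        forall x : 'rV[R]_n,
          poisson_bracket G (f \o phi) (h \o phi) x
          = poisson_bracket G' f h (phi x) &
      forall c : seq (half_edge n), closed_path G c ->
        (exists c', corresponding_path y1 z y2 c c') /\
        (forall c', corresponding_path y1 z y2 c c' ->
           closed_path G' c' /\
           forall x : 'rV[R]_n,
             geodesic_fun G x c = geodesic_fun G' (phi x) c')].
Proof.
move=> phi; have fl := pending_flip_flipped hz hG'; split.
- exact: spine_flipped fl hG.
- exact: smooth_flip_coord.
- move=> f h smooth_f smooth_h x; apply: (poisson_bracket_flip _ fl).
  + by case: hz.
  + exact: (smooth_f [::]).
  + exact: (smooth_h [::]).
- move=> c closed_c; split; first exact: corresponding_path_exists fl closed_c.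
  by move=> c' cc'; apply: corresponding_path_flip fl closed_c cc'.
Qed.
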